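(* For any $0<p\le\infty$, any $b\in\mathbb N$ with $b\ge 2$, and any $d\in\mathbb N$, the tensorization map $T_{b,d}$ is a linear isometry from $L^p([0,1))$ to the algebraic tensor space $\mathbf V_{b,d,L^p}:=(\mathbb R^b)^{\otimes d}\otimes L^p([0,1))$, where $\mathbf V_{b,d,L^p}$ is equipped with a reasonable crossnorm (namely the (quasi-)norm $\|\cdot\|_p$ written out in the context).
   Context: $I_b=\{0,\dots,b-1\}$, and $\mathbb R^b$ is identified with $\mathbb R^{I_b}$. The conversion map $t_{b,d}:I_b^d\times[0,1)\to[0,1)$ is $t_{b,d}(i_1,\dots,i_d,y)=\sum_{k=1}^d i_kb^{-k}+b^{-d}y$ (a bijection), and the tensorization map is $T_{b,d}f=f\circ t_{b,d}$, i.e. $(T_{b,d}f)(i_1,\dots,i_d,y)=f(t_{b,d}(i_1,\dots,i_d,y))$. The interval $[0,1)$ carries Lebesgue measure, and $L^p([0,1))$ its standard (quasi-)norm. The space $\mathbf V_{b,d,L^p}$ is identified with the space of functions $\boldsymbol f$ on $I_b^d\times[0,1)$ all of whose partial evaluations $\boldsymbol f(j_1,\dots,j_d,\cdot)$ lie in $L^p([0,1))$. The (quasi-)norm on $\mathbf V_{b,d,L^p}$ is $$\|\boldsymbol f\|_p^p=\sum_{j_1\in I_b}\cdots\sum_{j_d\in I_b} b^{-d}\,\|\boldsymbol f(j_1,\dots,j_d,\cdot)\|_{L^p([0,1))}^p\quad(p<\infty),\qquad \|\boldsymbol f\|_\infty=\max_{(j_1,\dots,j_d)\in I_b^d}\|\boldsymbol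 f(j_1,\dots,j_d,\cdot)\|_{L^\infty([0,1))}.$$ Each factor $\mathbb R^{I_b}$ is equipped with the normalized (quasi-)norm $\|v\|_{\ell^p}^p=b^{-1}\sum_{k=0}^{b-1}|v_k|^p$ for $p<\infty$, $\|v\|_{\ell^\infty}=\max_k|v_k|$, and is then denoted $\ell^p(I_b)$. A (quasi-)norm $\|\cdot\|$ on an algebraic tensor product $V_1\otimes\cdots\otimes V_{d+1}$ of (quasi-)normed spaces is a crossnorm if $\|v_1\otimes\cdots\otimes v_{d+1}\|=\prod_\nu\|v_\nu\|_{V_\nu}$ for all $v_\nu\in V_\nu$; a crossnorm is reasonable if, moreover, for all continuous linear functionals $\varphi_\nu\in V_\nu^*$, the functional $\varphi_1\otimes\cdots\otimes\varphi_{d+1}$ is bounded with $\sup_{\|\boldsymbol f\|\le1}|(\varphi_1\otimes\cdots\otimes\varphi_{d+1})(\boldsymbol f)|\le\prod_{\nu}\|\varphi_\nu\|_{V_\nu^*}$. Here $V_1=\dots=V_d=\ell^p(I_b)$ and $V_{d+1}=L^p([0,1))$. *)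

(* Defs.v *)
From HB Require Import structures.
From mathcomp Require Import all_boot all_order all_algebra.
From mathcomp Require Import generic_quotient ring_quotient.
From mathcomp Require Import all_classical all_reals all_analysis.
From mathcomp Require Import measurable_realfun ess_sup_inf.

Set Implicit Arguments.
Unset Strict Implicit.
Unset Printing Implicit Defensive.
Import Order.TTheory GRing.Theory Num.Theory.
Import numFieldNormedType.Exports.
Local Open Scope classical_set_scope.
Local Open Scope ring_scope.
Local Open Scope quotient_scope.

(** [Lfun mu p] is the library's set of measurable functions with finite
    [L^p] (quasi-)norm, but the library equips it with a module structure only
    for [1 <= p], and does not equip its quotient by a.e. equality with one.
    Here [Lp mu p0] is that quotient, as a vector space, for [p0 : 0 < p]. *)
Section Lfun_gt0.
Context d (T : measurableType d) (R : realType).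
Variable mu : {measure set T -> \bar R}.

Lemma LfunE (p : \bar R) f : reflect
  (measurable_fun [set: T] f /\ finite_norm mu p f) (f \in Lfun mu p).
Proof.
apply: (iffP andP) => -[mf nf]; split.
- by rewrite inE in mf.
- by rewrite inE in nf.
- by rewrite inE.
- by rewrite inE.
Qed.

Lemma Lfun_gt0_submod_closed (p : \bar R) :
  (0 < p)%E -> submod_closed (Lfun mu p).
Proof.
move=> p0; have [p1|p1] := leP 1%E p; first exact: (Lfun_submod_closed mu p1).
case: p p0 p1 => [r||]// r0 r1; rewrite lte_fin in r0.
have rn0 : r^-1 != 0 by rewrite invr_eq0 gt_eqF.
have fin f : finite_norm mu r%:E f <-> (\int[mu]_x (`|f x| `^ r)%:E < +oo)%E.
  rewrite /finite_norm unlock.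
  by split=> [/(lty_poweRy rn0)//|]; exact: poweR_lty.
split.
  apply/LfunE; split; first exact: measurable_cst.
  by rewrite /finite_norm (_ : EFin \o 0 = cst 0%E)// Lnorm0// eqe gt_eqF.
move=> a f g /LfunE[mf /fin nf] /LfunE[mg /fin ng].
have mpow (h : T -> R) : measurable_fun setT h ->
    measurable_fun setT (fun x => `|h x| `^ r).
  move=> mh; apply: (measurableT_comp (measurable_powR r)).
  exact: measurableT_comp.
apply/LfunE; split.
  by apply: measurable_funD => //; exact: measurable_funM.
apply/fin.
pose C1 := 2 `^ r * `|a| `^ r; pose C2 : R := 2 `^ r.
have C10 : 0 <= C1 by rewrite mulr_ge0 ?powR_ge0.
have C20 : 0 <= C2 by rewrite powR_ge0.
apply: (@le_lt_trans _ _
    (\int[mu]_x ((C1%:E * (`|f x| `^ r)%:E) + C2%:E * (`|g x| `^ r)%:E)))%E.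
  apply: ge0_le_integral => //.
  - apply/measurable_EFinP/mpow.
    by apply: measurable_funD => //; exact: measurable_funM.
  - by apply: emeasurable_funD; apply/measurable_EFinP;
      apply: measurable_funM => //; exact: mpow.
  move=> x _; rewrite -!EFinM -EFinD lee_fin.
  pose u := `|a| * `|f x|; pose v := `|g x|.
  have u0 : 0 <= u by rewrite mulr_ge0.
  have v0 : 0 <= v by exact: normr_ge0.
  rewrite /C1 -mulrA -powRM// -[X in _ <= X]mulrDr -/u -/v.
  have le1 : `|a *: f x + g x| <= 2 * Num.max u v.
    rewrite (le_trans (ler_normD _ _))// normrM -/u -/v mulr_natl mulr2n.
    by rewrite lerD// le_max lexx ?orbT.
  have m0 : 0 <= Num.max u v by rewrite le_max u0.
  apply: (@le_trans _ _ ((2 * Num.max u v) `^ r)).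
    by rewrite ge0_ler_powR ?nnegrE ?(ltW r0)// mulr_ge0.
  rewrite powRM// ler_wpM2l// maxEle.
  by case: ifP => _; rewrite ?lerDr ?lerDl powR_ge0.
have ge0 (h : T -> R) C : 0 <= C ->
    (forall x, [set: T] x -> 0 <= C%:E * (`|h x| `^ r)%:E)%E.
  by move=> C0 x _; rewrite mule_ge0 ?lee_fin ?powR_ge0.
rewrite ge0_integralD//; [|exact: ge0| |exact: ge0|].
- rewrite !ge0_integralZl_EFin//; [|exact/measurable_EFinP/mpow..].
  by rewrite lte_add_pinfty// lte_mul_pinfty// ?lee_fin.
- by apply/measurable_EFinP; apply: measurable_funM => //; exact: mpow.
- by apply/measurable_EFinP; apply: measurable_funM => //; exact: mpow.
Qed.

End Lfun_gt0.

Section Lp.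
Context d (T : measurableType d) (R : realType).
Variables (mu : {measure set T -> \bar R}) (p : \bar R) (p0 : (0 < p)%E).

Definition Lpset of (0 < p)%E : {pred T -> R} := Lfun mu p.

HB.instance Definition _ :=
  GRing.isSubmodClosed.Build _ _ (Lpset p0) (Lfun_gt0_submod_closed mu p0).

Record Lpfun := MkLpfun { Lpfun_val :> T -> R; _ : Lpfun_val \in Lpset p0 }.

HB.instance Definition _ := [isSub for Lpfun_val].
HB.instance Definition _ := [Choice of Lpfun by <:].
HB.instance Definition _ := [SubChoice_isSubLmodule of Lpfun by <:].

Definition Lpnull : {pred Lpfun} := [pred f : Lpfun | `[< f = cst 0 %[ae mu] >]].

Lemma Lpnull_zmod_closed : zmod_closed Lpnull.
Proof.
split; first by apply/asboolP/aeW.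
move=> f g /asboolP f0 /asboolP g0; apply/asboolP.
apply: filterS2 f0 g0 => x fx gx xT.
by rewrite [LHS](_ : _ = f x - g x)// fx// gx// subr0.
Qed.

HB.instance Definition _ := GRing.isZmodClosed.Build _ Lpnull Lpnull_zmod_closed.

Definition Lp : Type := Quotient.quot Lpnull.
HB.instance Definition _ := GRing.Zmodule.on Lp.
HB.instance Definition _ := Quotient.on Lp.

Lemma eq_piLp (f g : Lpfun) : \pi_Lp f = \pi_Lp g <-> f = g %[ae mu].
Proof.
split=> [/eqP|fg].
  rewrite -Quotient.idealrBE => /asboolP; apply: filterS => x + xT.
  move=> /(_ xT); rewrite [LHS](_ : _ = f x - g x)// => /eqP.
  by rewrite subr_eq0 => /eqP.
apply/eqP; rewrite -Quotient.idealrBE; apply/asboolP.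
apply: filterS fg => x /[apply] fgx.
by rewrite [LHS](_ : _ = f x - g x)// fgx subrr.
Qed.

Definition Lpscale (a : R) (F : Lp) : Lp := \pi_Lp (a *: repr F).

Lemma pi_Lpscale a f : \pi_Lp (a *: f) = Lpscale a (\pi_Lp f).
Proof.
apply/eq_piLp; have /eq_piLp : \pi_Lp f = \pi_Lp (repr (\pi_Lp f)) by rewrite reprK.
apply: filterS => x /[apply] fx.
by rewrite [LHS](_ : _ = a * f x)// fx.
Qed.

Lemma pi_Lpadd f g : \pi_Lp (f + g) = \pi_Lp f + \pi_Lp g.
Proof. exact: (Quotient.pi_add Lpnull). Qed.

Lemma LpscaleA a b F : Lpscale a (Lpscale b F) = Lpscale (a * b) F.
Proof.
elim/quotW: F => f; rewrite -(pi_Lpscale b f) -(pi_Lpscale a) scalerA.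
exact: pi_Lpscale.
Qed.

Lemma Lpscale1 : left_id 1 Lpscale.
Proof. by elim/quotW => f; rewrite -(pi_Lpscale 1 f) scale1r. Qed.

Lemma LpscaleDr : right_distributive Lpscale +%R.
Proof.
move=> a; elim/quotW => f; elim/quotW => g.
rewrite -(pi_Lpadd f g) -(pi_Lpscale a (f + g)) scalerDr pi_Lpadd.
by congr (_ + _); exact: pi_Lpscale.
Qed.

Lemma LpscaleDl F : {morph Lpscale^~ F : a b / a + b}.
Proof.
elim/quotW: F => f a b; rewrite -(pi_Lpscale (a + b) f) scalerDl pi_Lpadd.
by congr (_ + _); exact: pi_Lpscale.
Qed.

HB.instance Definition _ := GRing.Zmodule_isLmodule.Build R Lp
  LpscaleA Lpscale1 LpscaleDr LpscaleDl.

(* The class of [f]; it is meaningful only for [f \in Lfun mu p], and is [0]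
   otherwise. *)
Definition Lpclass (f : T -> R) : Lp := \pi_Lp (insubd (0 : Lpfun) f).

Definition Lpnorm (F : Lp) : R := fine ('N[mu]_p[EFin \o (repr F : T -> R)])%E.

Lemma eq_Lpclass f g : f \in Lfun mu p -> g \in Lfun mu p ->
  Lpclass f = Lpclass g <-> f = g %[ae mu].
Proof. by move=> fL gL; rewrite eq_piLp !insubdK. Qed.

Lemma LpnormE f : f \in Lfun mu p ->
  (Lpnorm (Lpclass f))%:E = ('N[mu]_p[EFin \o f])%E.
Proof.
move=> fL; have /eq_piLp : \pi_Lp (repr (Lpclass f)) = \pi_Lp (insubd 0 f).
  by rewrite reprK.
rewrite insubdK// /Lpnorm; move: (repr _) => [g gL] /= gf.
have /LfunE[mf nf] := fL; have /LfunE[mg ng] := gL.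
have <- : ('N[mu]_p[EFin \o g] = 'N[mu]_p[EFin \o f])%E.
  rewrite unlock /Lnorm; case: (p) p0 => [r _|_|//].
    congr (_ `^ _)%E; apply: ae_eq_integral => //.
    - apply: (measurableT_comp (measurable_poweR r)) => //.
      by apply: measurableT_comp => //; exact: measurableT_comp.
    - apply: (measurableT_comp (measurable_poweR r)) => //.
      by apply: measurableT_comp => //; exact: measurableT_comp.
    by apply: filterS gf => x /[apply] /= ->.
  by case: ifP => // _; apply: eq_ess_sup; apply: filterS gf => x /(_ I) /= ->.
by rewrite fineK// ge0_fin_numE// Lnorm_ge0.
Qed.

End Lp.

Arguments Lpnorm {d T R} mu {p} p0 F.

Section Quasinorm.
Context (R : realType) (V : lmodType R).
Variable N : V -> R.

Definition quasinorm : Prop :=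
  [/\ forall x, 0 <= N x,
      forall x, N x = 0 -> x = 0,
      forall (a : R) x, N (a *: x) = `|a| * N x &
      exists K : R, forall x y, N (x + y) <= K * (N x + N y)].

Definition triangle_ineq : Prop := forall x y, N (x + y) <= N x + N y.

Definition continuous_for (phi : V -> R) : Prop :=
  forall x e, 0 < e -> exists2 del, 0 < del &
    forall y, N (y - x) < del -> `|phi y - phi x| < e.

(* A supremum in [\bar R]: it is [+oo] exactly when [phi] is unbounded. *)
Definition dual_norm (phi : V -> R) : \bar R :=
  ereal_sup [set `|phi x|%:E | x in [set x | N x <= 1]].

End Quasinorm.

(** The algebraic tensor product of [d] copies of [R^b] with a vector space [L]
    is identified with the space of functions from [I_b^d] to [L]. *)
Notation "'R^[ R , b ]" := {ffun 'I_b -> R^o} (format "''R^[' R ,  b ]") : type_scope.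
Notation tensor_space b d L := {ffun {ffun 'I_d -> 'I_b} -> L}.

Section Tensor.
Context (R : realType) (b d : nat) (L : lmodType R).
Implicit Types (v : 'I_d -> 'R^[R, b]) (w : L) (f : tensor_space b d L).

Definition elem_tensor v w : tensor_space b d L :=
  [ffun j : {ffun 'I_d -> 'I_b} => (\prod_(k < d) (v k (j k) : R)) *: w].

Definition tensor_functional (phi : 'I_d -> {linear 'R^[R, b] -> R^o})
    (psi : {linear L -> R^o}) (Phi : {linear tensor_space b d L -> R^o}) : Prop :=
  forall v w, Phi (elem_tensor v w) = (\prod_(k < d) (phi k (v k) : R)) * psi w.

Definition crossnorm (NE : 'R^[R, b] -> R) (NL : L -> R)
    (N : tensor_space b d L -> R) : Prop :=
  quasinorm N /\
  forall v w, N (elem_tensor v w) = (\prod_(k < d) NE (v k)) * NL w.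

(* [Phi] below exists and is unique for all [phi] and [psi]: see
   [tensor_functional_ex] and [tensor_functional_uniq]. *)
Definition reasonable_crossnorm (NE : 'R^[R, b] -> R) (NL : L -> R)
    (N : tensor_space b d L -> R) : Prop :=
  crossnorm NE NL N /\
  forall (phi : 'I_d -> {linear 'R^[R, b] -> R^o}) (psi : {linear L -> R^o}),
    (forall k, continuous_for NE (phi k)) -> continuous_for NL psi ->
    exists2 Phi : {linear tensor_space b d L -> R^o},
      tensor_functional phi psi Phi &
      (dual_norm N Phi < +oo)%E /\
      (dual_norm N Phi <=
        (\prod_(k < d) dual_norm NE (phi k)) * dual_norm NL psi)%E.

Let delta (i : 'I_b) : 'R^[R, b] := [ffun i' => (i' == i)%:R].

Lemma elem_tensor_span f :
  f = \sum_(j : {ffun 'I_d -> 'I_b}) elem_tensor (fun k => delta (j k)) (f j).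
Proof.
apply/ffunP => i; rewrite sum_ffunE (bigD1 i)//= big1 ?addr0; last first.
  move=> j ji; rewrite ffunE; have /existsP[k jk] : [exists k, i k != j k].
    rewrite -negb_forall; apply: contra ji => /forallP ij.
    by apply/eqP/ffunP => k; rewrite (eqP (ij k)).
  by rewrite (bigD1 k)//= ffunE (negbTE jk) mul0r scale0r.
by rewrite ffunE big1 ?scale1r// => k _; rewrite ffunE eqxx.
Qed.

Lemma tensor_functional_uniq phi psi Phi1 Phi2 :
  tensor_functional phi psi Phi1 -> tensor_functional phi psi Phi2 ->
  Phi1 =1 Phi2.
Proof.
move=> H1 H2 f; rewrite (elem_tensor_span f) !linear_sum.
by apply: eq_bigr => j _; rewrite H1 H2.
Qed.

Lemma tensor_functional_ex phi psi : exists Phi, tensor_functional phi psi Phi.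
Proof.
pose F (f : tensor_space b d L) : R^o := \sum_(j : {ffun 'I_d -> 'I_b})
  (\prod_(k < d) (phi k (delta (j k)) : R)) * psi (f j).
have Flin : linear F.
  move=> a f g; rewrite /F scaler_sumr -big_split; apply: eq_bigr => j _ /=.
  by rewrite !ffunE linearP mulrDr [a *: (_ * _)]mulrCA.
pose Phi : {linear tensor_space b d L -> R^o} :=
  HB.pack F (GRing.isLinear.Build _ _ _ _ F Flin).
exists Phi => v w; rewrite [LHS](_ : _ = F (elem_tensor v w))// /F.
under eq_bigr => j _ do rewrite ffunE linearZ/= mulrA -big_split/=.
rewrite -mulr_suml; congr (_ * _).
rewrite -(bigA_distr_bigA (fun k i => phi k (delta i) * v k i)).
apply: eq_bigr => k _; rewrite [in RHS](_ : v k = \sum_i (v k i : R) *: delta i).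
  by rewrite linear_sum; apply: eq_bigr => i _; rewrite linearZ/= mulrC.
apply/ffunP => i; rewrite sum_ffunE (bigD1 i)//= big1 ?addr0.
  by rewrite !ffunE eqxx [RHS]mulr1.
by move=> i' ii'; rewrite !ffunE eq_sym (negbTE ii') [LHS]mulr0.
Qed.

End Tensor.

Definition lebesgue01 (R : realType) : {measure set (measurableTypeR R) -> \bar R} :=
  mrestr lebesgue_measure (measurable_itv `[(0 : R), 1[).

(** [L^p([0,1))]: functions on [[0,1)] are represented by functions on [R],
    identified when they agree a.e. on [[0,1)]. *)
Notation Lp01 R p0 := (Lp (lebesgue01 R) p0).

Section Tensorization.
Context (R : realType) (b d : nat).
Implicit Types (i : {ffun 'I_d -> 'I_b}) (y : R).

(* Ordinals are numbered from 0, hence the exponent [k.+1]. *)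
Definition tconv i y : R :=
  \sum_(k < d) (i k)%:R * b%:R ^- k.+1 + b%:R ^- d * y.

Definition tensorize (f : R -> R) : {ffun 'I_d -> 'I_b} -> R -> R :=
  fun i y => f (tconv i y).

Variables (p : \bar R) (p0 : (0 < p)%E).

(* The action of [tensorize] on classes, through representatives; [Lpclass] is
   total, so that [tensorize _ i] being in [L^p] is left to be proved. *)
Definition Tmap (F : Lp01 R p0) : tensor_space b d (Lp01 R p0) :=
  [ffun i => Lpclass (lebesgue01 R) p0 (tensorize (repr F : R -> R) i)].

(* In the next two definitions [p] is positive, so that the last case is
   [p = +oo]. *)
Definition ellp_norm (v : 'R^[R, b]) : R :=
  match p with
  | r%:E => (b%:R^-1 * \sum_(k < b) `|v k : R| `^ r) `^ r^-1
  | _ => \big[Num.max/0]_(k < b) `|v k : R|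
  end.

Definition tensor_norm (f : tensor_space b d (Lp01 R p0)) : R :=
  match p with
  | r%:E =>
    (\sum_(j : {ffun 'I_d -> 'I_b}) b%:R ^- d * Lpnorm _ _ (f j) `^ r) `^ r^-1
  | _ => \big[Num.max/0]_(j : {ffun 'I_d -> 'I_b}) Lpnorm _ _ (f j)
  end.

End Tensorization.

Arguments Tmap {R} b d {p} p0 F.
Arguments ellp_norm {R} b p v.
Arguments tensor_norm {R} b d {p} p0 f.

(* Main.v *)
Require Import Defs.
From HB Require Import structures.
From mathcomp Require Import all_boot all_order all_algebra.
From mathcomp Require Import all_classical all_reals all_analysis.
From mathcomp Require Import measurable_realfun ess_sup_inf.
From mathcomp Require Import ring lra.

(** Since [t_(d+1) (i :: j, y) = (i + t_d (j, y)) / b], induction on [d] reduces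
    the isometry to the scaling of Lebesgue measure under [y |-> (i + y) / b] and
    the partition of [[0, 1)] into [b] intervals: the integral over [[0, 1)] is
    the mean over [j] of the integrals along [t_d (j, .)], and a measurable set
    is null iff all its preimages are.  For the bound on
    [phi_1 (x) ... (x) phi_d (x) psi], [psi] is first bounded slicewise; the
    remaining sum of [\prod_k |phi_k (delta_(j_k))|] times the norms of the
    slices is contracted one coordinate at a time, which needs no Hoelder
    inequality and so covers [r < 1]. *)

Set Implicit Arguments.
Unset Strict Implicit.

Import Order.TTheory GRing.Theory Num.Theory.
Import numFieldNormedType.Exports.
Local Open Scope classical_set_scope.
Local Open Scope ring_scope.

(** * Lebesgue measure under the conversion map *)

(* A name for the canonical instance, whose argument [mphi] is not inferred. *)
Definition image_measure d1 d2 (T1 : measurableType d1) (T2 : measurableType d2)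
    (R : realType) (mu : {measure set T1 -> \bar R}) (phi : T1 -> T2)
    (mphi : measurable_fun setT phi) : {measure set T2 -> \bar R} :=
  measure_function_pushforward__canonical__measure_function_Measure mu mphi.

(** * Splitting off the first coordinate of a multi-index *)

Section ffun_ordS.
Variables (I : finType) (d : nat).
Implicit Types (i : I) (g : {ffun 'I_d -> I}).

Definition fcons i g : {ffun 'I_d.+1 -> I} :=
  [ffun k => if unlift ord0 k is Some k' then g k' else i].

Lemma fcons0 i g : fcons i g ord0 = i.
Proof. by rewrite ffunE unlift_none. Qed.

Lemma fconsS i g k : fcons i g (lift ord0 k) = g k.
Proof. by rewrite ffunE liftK. Qed.

(** A multi-index amounts to its first coordinate and the remaining ones; this reindexing drives the
    inductions on [d]. *)
Lemma big_fcons (T : Type) (idx : T) (op : Monoid.com_law idx)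
    (F : {ffun 'I_d.+1 -> I} -> T) :
  \big[op/idx]_f F f =
  \big[op/idx]_i \big[op/idx]_(g : {ffun 'I_d -> I}) F (fcons i g).
Proof.
rewrite pair_bigA (reindex (fun u : I * {ffun 'I_d -> I} => fcons u.1 u.2))//.
exists (fun f : {ffun 'I_d.+1 -> I} =>
    (f ord0, [ffun k : 'I_d => f (lift ord0 k)])) => [[i g] _|f _] /=.
  rewrite fcons0; congr pair.
  by apply/ffunP => k; rewrite ffunE fconsS.
apply/ffunP => k; case: (unliftP ord0 k) => [k' ->|->].
  by rewrite fconsS ffunE.
by rewrite fcons0.
Qed.

End ffun_ordS.

Lemma big_ffun_ord0 (I : finType) (T : Type) (idx : T) (op : Monoid.com_law idx)
    (F : {ffun 'I_0 -> I} -> T) (g0 : {ffun 'I_0 -> I}) :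
  \big[op/idx]_f F f = F g0.
Proof.
rewrite (bigD1 g0)//= big1 ?Monoid.mulm1// => g /eqP[].
by apply/ffunP => -[].
Qed.

(** * Base-[b] subdivision of the unit interval *)

Section lebesgue01_tconv.
Context (R : realType) (b : nat) (b0 : (0 < b)%N).
Implicit Types (i : nat) (A : set R).

Let bR0 : (0 : R) < b%:R. Proof. by rewrite ltr0n. Qed.

(** The right-hand side is a measure in [A], namely [b^-1] times an image of Lebesgue measure. By
    uniqueness it suffices to test half-open intervals, where the preimage is [b] times as long. *)
Lemma lebesgue_measure_affine (a : R) A : measurable A ->
  lebesgue_measure A =
  ((b%:R^-1)%:E *
    lebesgue_measure ((fun y : R => (a + y) / b%:R)%R @^-1` A))%E.
Proof.
pose phi (y : R) := (a + y) / b%:R.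
have mphi : measurable_fun setT phi.
  by apply: measurable_funM => //; exact: measurable_funD.
have binv0 : 0 <= (b%:R^-1 : R) by rewrite invr_ge0 ler0n.
pose nu : {measure set (measurableTypeR R) -> \bar R} :=
  mscale (NngNum binv0)
    (@image_measure _ _ _ (measurableTypeR R) _ lebesgue_measure _ mphi).
move=> mA; rewrite (@lebesgue_measure_unique _ nu _ A)// => X.
move=> /ocitvP[->|[[x y] /= xy ->]].
  by rewrite !measure0.
rewrite /nu /mscale /= /pushforward lebesgue_measure_itv /= lte_fin xy.
rewrite [X in lebesgue_measure X](_ : _ = `]b%:R * x - a, b%:R * y - a]%classic).
  rewrite lebesgue_measure_itv /= lte_fin ltrD2r ltr_pM2l// xy.
  rewrite -!EFinD -EFinM; congr EFin; field.
  by rewrite gt_eqF.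
apply/seteqP; split => z /=; rewrite !in_itv/= ltr_pdivlMr// ler_pdivrMr//.
  by move=> /andP[? ?]; apply/andP; split; lra.
by move=> /andP[? ?]; apply/andP; split; lra.
Qed.

(** For [i < b] this sends [[0, 1)] onto the [i]-th of its [b] equal subintervals: it prepends the
    digit [i] to the base-[b] expansion of [y]. *)
Definition subdiv i (y : R) : R := (i%:R + y) / b%:R.

Lemma measurable_subdiv i : measurable_fun setT (subdiv i).
Proof. by apply: measurable_funM => //; exact: measurable_funD. Qed.

Lemma lebesgue01_subdiv A : measurable A ->
  lebesgue01 R A =
  (\sum_(i < b) (b%:R^-1)%:E * lebesgue01 R (subdiv i @^-1` A))%E.
Proof.
move=> mA.
(* Scaling with offset [i] carries the [i]-th subinterval back to [[0, 1)]. *)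
have piece i : lebesgue_measure (A `&` `[i%:R / b%:R, i.+1%:R / b%:R[) =
    ((b%:R^-1)%:E * lebesgue01 R (subdiv i @^-1` A))%E.
  rewrite (@lebesgue_measure_affine (i%:R)); last exact: measurableI.
  congr (_ * _)%E; rewrite /lebesgue01 /mrestr; congr lebesgue_measure.
  rewrite preimage_setI; congr (_ `&` _); apply/seteqP; split => z /=;
    rewrite !in_itv/= ler_pdivrMr// ltr_pdivrMr// !divfK ?gt_eqF// -natr1;
    by move=> /andP[? ?]; apply/andP; split; lra.
(* General [n] lets the subintervals be glued one at a time; [n = b] gives all of [[0, 1)]. *)
have part n : lebesgue_measure (A `&` `[(0 : R), n%:R / b%:R[) =
    (\sum_(i < n) lebesgue_measure
      (A `&` `[(i%:R / b%:R : R)%R, (i.+1%:R / b%:R)%R[))%E.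
  elim: n => [|n IHn].
    by rewrite big_ord0 mul0r set_itvco0 setI0 measure0.
  rewrite big_ord_recr /= -IHn -measureU//; [|exact: measurableI..|].
    rewrite -setIUr; congr (lebesgue_measure (_ `&` _)).
    apply/seteqP; split => z /=; rewrite !in_itv/=.
      by move=> /andP[-> ->]; case: ltP => _; [left|right].
    have n0 : (0 : R) <= n%:R / b%:R by rewrite divr_ge0.
    have nS : (n%:R / b%:R : R) < n.+1%:R / b%:R.
      by rewrite ltr_pM2r ?invr_gt0// ltr_nat.
    by move=> [] /andP[? ?]; apply/andP; split; lra.
  apply/seteqP; split => z //= [[_ +] [_ +]]; rewrite !in_itv/=.
  by move=> /andP[_ /lt_geF ->].
have -> : lebesgue01 R A = lebesgue_measure (A `&` `[(0 : R), b%:R / b%:R[).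
  by rewrite divff// gt_eqF.
by rewrite part; apply: eq_bigr.
Qed.

(** By [lebesgue01_subdiv] the measure is a sum of [b] rescaled images of itself, so the integral
    splits accordingly and each term is a change of variables. *)
Lemma integral_subdiv (f : R -> \bar R) :
    measurable_fun setT f -> (forall x, 0 <= f x)%E ->
  (\int[lebesgue01 R]_x f x =
   \sum_(i < b) (b%:R^-1)%:E * \int[lebesgue01 R]_x f (subdiv i x))%E.
Proof.
move=> mf f0.
have binv0 : 0 <= (b%:R^-1 : R) by rewrite invr_ge0 ler0n.
pose m (i : nat) : {measure set (measurableTypeR R) -> \bar R} :=
  mscale (NngNum binv0)
    (@image_measure _ _ _ (measurableTypeR R) _ (lebesgue01 R) _
      (measurable_subdiv i)).
rewrite (eq_measure_integral (msum m b)); last first.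
  by move=> A mA _; rewrite lebesgue01_subdiv.
rewrite ge0_integral_measure_sum//; apply: eq_bigr => i _.
rewrite ge0_integral_mscale//= ge0_integral_pushforward//.
exact: measurable_subdiv.
Qed.

Lemma tconv_fcons d (i : 'I_b) (g : {ffun 'I_d -> 'I_b}) (y : R) :
  tconv (fcons i g) y = subdiv i (tconv g y).
Proof.
rewrite /tconv /subdiv big_ord_recl fcons0 expr1 mulrDl -addrA; congr (_ + _).
rewrite mulrDl big_distrl/=; congr (_ + _).
  by apply: eq_bigr => k _; rewrite fconsS -mulrA -invfM -exprSr.
by rewrite mulrAC -invfM -exprSr.
Qed.

Lemma measurable_tconv d (j : {ffun 'I_d -> 'I_b}) :
  measurable_fun setT (tconv j : R -> R).
Proof. by apply: measurable_funD => //; exact: measurable_funM. Qed.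

(** [integral_subdiv] peels off the first digit, and the induction hypothesis is applied to [f]
    composed with [subdiv i]. *)
Lemma integral_tconv d (f : R -> \bar R) :
    measurable_fun setT f -> (forall x, 0 <= f x)%E ->
  (\int[lebesgue01 R]_x f x = \sum_(j : {ffun 'I_d -> 'I_b})
    (b%:R ^- d)%:E * \int[lebesgue01 R]_x f (tconv j x))%E.
Proof.
elim: d f => [|d IHd] f mf f0.
  rewrite (big_ffun_ord0 _ _ [ffun=> Ordinal b0]) expr0 invr1 mul1e.
  by apply: eq_integral => x _; rewrite /tconv big_ord0 add0r expr0 invr1 mul1r.
rewrite integral_subdiv// big_fcons; apply: eq_bigr => i _.
rewrite IHd//; last exact: measurableT_comp (measurable_subdiv i).
rewrite ge0_sume_distrr; last first.
  by move=> j _; rewrite mule_ge0 ?integral_ge0// lee_fin invr_ge0 exprn_ge0.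
apply: eq_bigr => j _; rewrite muleA -EFinM -invfM -exprS; congr (_ * _)%E.
by apply: eq_integral => x _; rewrite tconv_fcons.
Qed.

Lemma lebesgue01_tconv d A : measurable A ->
  lebesgue01 R A = (\sum_(j : {ffun 'I_d -> 'I_b})
    (b%:R ^- d)%:E * lebesgue01 R (tconv j @^-1` A))%E.
Proof.
move=> mA; have := @integral_tconv d (fun x => (\1_A x)%:E).
rewrite integral_indic// setIT => ->//; last first.
  exact/measurable_EFinP.
apply: eq_bigr => j _; congr (_ * _)%E.
rewrite -[X in lebesgue01 R X]setIT -integral_indic//.
by rewrite -[X in measurable X]setTI; exact: measurable_tconv.
Qed.

(** A sum of nonnegative terms with positive weights vanishes iff every term does. One direction
    passes a.e. statements to the slices, the other recovers essential bounds from the slices. *)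
Lemma lebesgue01_tconv_eq0 d A : measurable A ->
  lebesgue01 R A = 0 <->
  forall j : {ffun 'I_d -> 'I_b}, lebesgue01 R (tconv j @^-1` A) = 0.
Proof.
move=> mA; rewrite (lebesgue01_tconv d)//; split => [+ j|A0]; last first.
  by rewrite big1// => j _; rewrite A0 mule0.
have bd0 : (0 < (b%:R ^- d)%:E :> \bar R)%E by rewrite lte_fin invr_gt0 exprn_gt0.
move/eqP; rewrite seq_psume_eq0; last by move=> i _; rewrite mule_ge0// ltW.
move=> /allP /(_ j (mem_index_enum _)); rewrite mule_eq0 gt_eqF//= => /eqP.
exact.
Qed.

Lemma ae_tconv d (j : {ffun 'I_d -> 'I_b}) (P : R -> Prop) :
  (\forall x \ae lebesgue01 R, P x) ->
  \forall y \ae lebesgue01 R, P (tconv j y).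
Proof.
move=> [N [mN N0 PN]]; exists (tconv j @^-1` N); split.
- by rewrite -[X in measurable X]setTI; exact: measurable_tconv.
- by have /(lebesgue01_tconv_eq0 d mN) := N0; apply.
- by move=> y Py; apply: PN.
Qed.

(** Since [f] is measurable, so is the exceptional set where [f] exceeds [M]; it is null because all
    its preimages are. *)
Lemma ae_le_tconv d (f : R -> \bar R) (M : \bar R) : measurable_fun setT f ->
  (forall j : {ffun 'I_d -> 'I_b},
    \forall y \ae lebesgue01 R, (f (tconv j y) <= M)%E) ->
  \forall x \ae lebesgue01 R, (f x <= M)%E.
Proof.
move=> mf fM; apply/ae_le_measureP => //; apply/(lebesgue01_tconv_eq0 d).
  rewrite -[X in measurable X]setTI.
  by apply: mf => //; exact: emeasurable_itv.
move=> j; have /ae_le_measureP := fM j; apply.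
exact: measurableT_comp mf (measurable_tconv j).
Qed.

End lebesgue01_tconv.

(** * Quasi-norms on Lp *)

Section powR_ge0.
Context (R : realType) (r : R) (r0 : 0 < r).
Implicit Types x y : R.

Lemma ler_powR2r x y : 0 <= x -> 0 <= y -> (x `^ r <= y `^ r) = (x <= y).
Proof.
move=> x0 y0; have [xy|yx] := leP x y.
  by rewrite ge0_ler_powR// ltW.
by apply/negbTE; rewrite -ltNge gt0_ltr_powR.
Qed.

Lemma powRVK x : 0 <= x -> (x `^ r) `^ r^-1 = x.
Proof. by move=> x0; rewrite -powRrM divff ?gt_eqF// powRr1. Qed.

Lemma powRKV x : 0 <= x -> (x `^ r^-1) `^ r = x.
Proof. by move=> x0; rewrite -powRrM mulVf ?gt_eqF// powRr1. Qed.

Lemma powR_prod (I : finType) (F : I -> R) : (forall i, 0 <= F i) ->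
  (\prod_i F i) `^ r = \prod_i F i `^ r.
Proof.
(* Nonnegativity of the partial products is carried along because [powRM] requires it. *)
move=> F0; suff [] : 0 <= \prod_i F i /\ (\prod_i F i) `^ r = \prod_i F i `^ r.
  by [].
elim/big_rec2 : _ => [|i x y _ [y0 yx]]; first by rewrite powR1.
by rewrite mulr_ge0// powRM// yx.
Qed.

(* [x + y <= 2 max(x, y)] *)
Lemma powRD_le x y : 0 <= x -> 0 <= y ->
  (x + y) `^ r <= 2 `^ r * (x `^ r + y `^ r).
Proof.
move=> x0 y0; wlog xy : x y x0 y0 / x <= y => [H|].
  have [xy|/ltW yx] := leP x y; first exact: H.
  by rewrite addrC (addrC (x `^ r)); exact: H.
apply: (@le_trans _ _ ((2 * y) `^ r)).
  by rewrite ler_powR2r ?addr_ge0 ?mulr_ge0// mulr_natl mulr2n lerD2r.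
by rewrite powRM// ler_wpM2l ?powR_ge0// lerDr powR_ge0.
Qed.

Lemma powRD_ge x y : 0 <= x -> 0 <= y ->
  x `^ r + y `^ r <= 2 * (x + y) `^ r.
Proof.
move=> x0 y0; rewrite mulr_natl mulr2n.
by rewrite lerD// ler_powR2r ?addr_ge0// ?lerDl ?lerDr.
Qed.

End powR_ge0.

(** * Vector operations and the quasi-norm on classes *)

Section Lp_norm.
Context d (T : measurableType d) (R : realType).
Variables (mu : {measure set T -> \bar R}).
Local Notation class p0 f := (Lpclass mu p0 f).

Section basics.
Variables (p : \bar R) (p0 : (0 < p)%E).
Implicit Types (F G : Lp mu p0).

Lemma Lfun_repr F : (repr F : T -> R) \in Lfun mu p.
Proof. exact: (valP (repr F)). Qed.

Lemma Lpclass_repr F : class p0 (repr F : T -> R) = F.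
Proof. by rewrite /Lpclass valKd reprK. Qed.

(** Induction principle: every class has a representative in [Lfun mu p], so the junk value of
    [Lpclass] never has to be considered. *)
Lemma LpW (P : Lp mu p0 -> Prop) :
  (forall f, f \in Lfun mu p -> P (class p0 f)) -> forall F, P F.
Proof. by move=> Pf F; rewrite -(Lpclass_repr F); exact/Pf/Lfun_repr. Qed.

Lemma LfunDZ a f g : f \in Lfun mu p -> g \in Lfun mu p ->
  (fun x => a * f x + g x) \in Lfun mu p.
Proof. by have [_] := Lfun_gt0_submod_closed mu p0; exact. Qed.

Lemma Lfun_cst0 : (cst 0 : T -> R) \in Lfun mu p.
Proof. by have [] := Lfun_gt0_submod_closed mu p0. Qed.

Lemma LpclassDZ a f g : f \in Lfun mu p -> g \in Lfun mu p ->
  class p0 (fun x => a * f x + g x) = a *: class p0 f + class p0 g.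
Proof.
move=> fL gL; rewrite /Lpclass -[RHS]/(Lpscale a _ + _) -pi_Lpscale -pi_Lpadd.
apply/eq_piLp; apply: aeW => x _; rewrite insubdK; last exact: LfunDZ.
rewrite [RHS](_ : _ = a * (insubd (0 : Lpfun mu p0) f : T -> R) x +
  (insubd (0 : Lpfun mu p0) g : T -> R) x)//.
by rewrite !insubdK.
Qed.

Lemma Lpclass_cst0 : class p0 (cst 0 : T -> R) = 0.
Proof.
have := LpclassDZ 0 Lfun_cst0 Lfun_cst0; rewrite scale0r add0r => h.
(* With scalar [-1] the right-hand side is the class of the zero function minus itself. *)
have := LpclassDZ (-1) Lfun_cst0 Lfun_cst0; rewrite scaleN1r addNr => <-.
by congr Lpclass; apply/funext => x; rewrite mulr0 addr0.
Qed.

Lemma LpclassD f g : f \in Lfun mu p -> g \in Lfun mu p ->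
  class p0 (f \+ g) = class p0 f + class p0 g.
Proof.
move=> fL gL; rewrite -[in RHS](scale1r (class p0 f)) -LpclassDZ//.
by congr Lpclass; apply/funext => x /=; rewrite mul1r.
Qed.

Lemma LfunD f g : f \in Lfun mu p -> g \in Lfun mu p -> f \+ g \in Lfun mu p.
Proof.
move=> fL gL; rewrite (_ : f \+ g = fun x => 1 * f x + g x); first exact: LfunDZ.
by apply/funext => x /=; rewrite mul1r.
Qed.

Lemma LpclassZ a f : f \in Lfun mu p ->
  class p0 (fun x => a * f x) = a *: class p0 f.
Proof.
move=> fL; rewrite -[RHS]addr0 -Lpclass_cst0 -LpclassDZ//; last exact: Lfun_cst0.
by congr Lpclass; apply/funext => x /=; rewrite addr0.
Qed.

Lemma LfunZ a f : f \in Lfun mu p -> (fun x => a * f x) \in Lfun mu p.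
Proof.
move=> fL; rewrite (_ : (fun x => _) = fun x => a * f x + cst 0 x).
  by apply: LfunDZ => //; exact: Lfun_cst0.
by apply/funext => x /=; rewrite addr0.
Qed.

Lemma Lpnorm_ge0 F : 0 <= Lpnorm mu p0 F.
Proof. exact/fine_ge0/Lnorm_ge0. Qed.

Lemma Lpnorm_eq0 F : Lpnorm mu p0 F = 0 -> F = 0.
Proof.
elim/LpW : F => f fL N0; rewrite -Lpclass_cst0; apply/eq_Lpclass => //.
  exact: Lfun_cst0.
have := LpnormE p0 fL; rewrite N0 => /esym/Lnorm_eq0_eq0.
have /LfunE[mf _] := fL.
move=> /(_ (measurableT_comp (@EFin_measurable _ setT) mf) p0).
by apply: filterS => x /[apply] -[].
Qed.

Lemma Lpnorm_triangle F G : (1 <= p)%E ->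
  Lpnorm mu p0 (F + G) <= Lpnorm mu p0 F + Lpnorm mu p0 G.
Proof.
move=> p1; elim/LpW : F => f fL; elim/LpW : G => g gL.
rewrite -lee_fin EFinD -LpclassD// !LpnormE//; last exact: LfunD.
by have /LfunE[mf _] := fL; have /LfunE[mg _] := gL; exact: eminkowski.
Qed.

End basics.

Section finite.
Variables (r : R) (p0 : (0 < r%:E)%E).
Let r0 : 0 < r. Proof. by move: p0; rewrite lte_fin. Qed.

Lemma powR_Lpnorm f : f \in Lfun mu r%:E ->
  (Lpnorm mu p0 (class p0 f) `^ r)%:E = (\int[mu]_x (`|f x| `^ r)%:E)%E.
Proof.
move=> fL; rewrite -poweR_EFin LpnormE// poweR_Lnorm ?gt_eqF//.
Qed.

Lemma measurable_powR_norm f : f \in Lfun mu r%:E ->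
  measurable_fun setT (fun x => (`|f x| `^ r)%:E).
Proof.
move=> /LfunE[mf _]; apply/measurable_EFinP.
by apply: (measurableT_comp (measurable_powR r)); exact: measurableT_comp.
Qed.

(** Raising to the power [r] is injective on nonnegative reals and turns the norm into an integral,
    out of which the constant is taken. *)
Lemma LpnormZ_fin a (F : Lp mu p0) :
  Lpnorm mu p0 (a *: F) = `|a| * Lpnorm mu p0 F.
Proof.
elim/LpW : F => f fL.
have n0 := Lpnorm_ge0 (class p0 f); have n1 := Lpnorm_ge0 (a *: class p0 f).
apply: (powR_injective r0); rewrite ?nnegrE ?mulr_ge0// powRM//.
apply: EFin_inj; rewrite -LpclassZ// EFinM !powR_Lpnorm//; last exact: LfunZ.
rewrite -ge0_integralZl_EFin ?powR_ge0//; last exact: measurable_powR_norm.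
by apply: eq_integral => x _; rewrite normrM powRM.
Qed.

(** The pointwise bound [powRD_le], integrated; it stands in for Minkowski when [r < 1]. *)
Lemma powR_LpnormD (F G : Lp mu p0) : Lpnorm mu p0 (F + G) `^ r <=
  2 `^ r * (Lpnorm mu p0 F `^ r + Lpnorm mu p0 G `^ r).
Proof.
elim/LpW : F => f fL; elim/LpW : G => g gL.
have ge0 (h : T -> R) x : (0 <= (`|h x| `^ r)%:E)%E by rewrite lee_fin powR_ge0.
have fgL := LfunD p0 fL gL.
rewrite -lee_fin EFinM EFinD -LpclassD// !powR_Lpnorm//.
have mf := measurable_powR_norm fL; have mg := measurable_powR_norm gL.
have mfg := measurable_powR_norm fgL.
rewrite -ge0_integralD// -ge0_integralZl_EFin ?powR_ge0//; last first.
  exact: emeasurable_funD.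
  by move=> x _; rewrite adde_ge0.
apply: ge0_le_integral => //.
  by apply/measurable_funeM/emeasurable_funD.
move=> x _; rewrite -EFinD -EFinM lee_fin; apply: le_trans (powRD_le _ _ _) => //.
by rewrite ler_powR2r ?addr_ge0// ler_normD.
Qed.

End finite.

Section infinite.
Variable (p0 : (0 < +oo :> \bar R)%E).

Lemma Lpnorm_le f M : f \in Lfun mu +oo%E -> 0 <= M ->
  Lpnorm mu p0 (class p0 f) <= M <-> \forall x \ae mu, (`|f x|%:E <= M%:E)%E.
Proof.
move=> fL M0; rewrite -lee_fin LpnormE// unlock; case: ifPn => [mu0|].
  by split=> [/ess_supP|] fM; [|apply/ess_supP]; apply: filterS fM.
(* If the whole space is null, the norm is [0] by convention and every property holds a.e. *)
rewrite -leNgt measure_le0 => /eqP mu0; split=> // _.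
by exists setT; split.
Qed.

Lemma ae_Lpnorm f : f \in Lfun mu +oo%E ->
  \forall x \ae mu, (`|f x|%:E <= (Lpnorm mu p0 (class p0 f))%:E)%E.
Proof. by move=> fL; apply/Lpnorm_le => //; exact: Lpnorm_ge0. Qed.

Lemma LpnormZ_le a (F : Lp mu p0) :
  Lpnorm mu p0 (a *: F) <= `|a| * Lpnorm mu p0 F.
Proof.
elim/LpW : F => f fL; rewrite -LpclassZ//; apply/Lpnorm_le.
- exact: LfunZ.
- by rewrite mulr_ge0 ?Lpnorm_ge0.
apply: filterS (ae_Lpnorm fL) => x; rewrite !lee_fin normrM => fx.
by rewrite ler_wpM2l.
Qed.

Lemma LpnormZ_oo a (F : Lp mu p0) :
  Lpnorm mu p0 (a *: F) = `|a| * Lpnorm mu p0 F.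
Proof.
apply/le_anti; rewrite LpnormZ_le/=; have [->|a0] := eqVneq a 0.
  by rewrite normr0 mul0r Lpnorm_ge0.
(* The reverse inequality is [LpnormZ_le] for the scalar [a^-1] and the vector [a *: F]. *)
rewrite -ler_pdivlMl ?normr_gt0// -normfV -[X in Lpnorm _ _ X <= _](scalerK a0).
exact: LpnormZ_le.
Qed.

End infinite.

Lemma LpnormZ (p : \bar R) (p0 : (0 < p)%E) a (F : Lp mu p0) :
  Lpnorm mu p0 (a *: F) = `|a| * Lpnorm mu p0 F.
Proof.
by case: p p0 F => [r||] p0 F //; [exact: LpnormZ_fin|exact: LpnormZ_oo].
Qed.

End Lp_norm.

(** * The tensorization map *)

Lemma ae_imp d (T : measurableType d) (R : realType)
    (mu : {measure set T -> \bar R}) (P Q : T -> Prop) :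
  (forall x, P x -> Q x) -> (\forall x \ae mu, P x) -> \forall x \ae mu, Q x.
Proof. by move=> PQ; apply: filterS. Qed.

Section Lfun_criteria.
Context d (T : measurableType d) (R : realType).
Variables (mu : {measure set T -> \bar R}).

Lemma Lfun_finP (r : R) (p0 : (0 < r%:E)%E) f : f \in Lfun mu r%:E <->
  measurable_fun setT f /\ (\int[mu]_x (`|f x| `^ r)%:E < +oo)%E.
Proof.
split=> [fL|[mf fr]]; first by rewrite -powR_Lpnorm// ltry; have /LfunE[] := fL.
by apply/LfunE; split=> //; rewrite /finite_norm unlock; exact: poweR_lty.
Qed.

Lemma Lfun_ooP f : f \in Lfun mu +oo%E <->
  measurable_fun setT f /\ exists M : R, \forall x \ae mu, (`|f x|%:E <= M%:E)%E.
Proof.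
have p0 : (0 < +oo :> \bar R)%E by [].
split=> [fL|[mf [M fM]]].
  split; first by have /LfunE[] := fL.
  by exists (Lpnorm mu p0 (Lpclass mu p0 f)); exact: ae_Lpnorm.
apply/LfunE; split=> //; rewrite /finite_norm unlock; case: ifP => // _.
by apply: (@le_lt_trans _ _ M%:E); [apply/ess_supP|rewrite ltry].
Qed.

End Lfun_criteria.

(** * Well-definedness, linearity and isometry *)

Section isometry.
Context (R : realType) (b d : nat) (b0 : (0 < b)%N).
Local Notation mu := (lebesgue01 R).

Let bd0 : 0 < (b%:R ^- d : R). Proof. by rewrite invr_gt0 exprn_gt0// ltr0n. Qed.

Section any_exponent.
Variables (p : \bar R) (p0 : (0 < p)%E).
Implicit Types (f g : R -> R) (j : {ffun 'I_d -> 'I_b}).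

Lemma measurable_tensorize f j :
  measurable_fun setT f -> measurable_fun setT (tensorize f j).
Proof. by move=> mf; exact: measurableT_comp mf (measurable_tconv j). Qed.

Lemma tensorize_Lfun f j : f \in Lfun mu p -> tensorize f j \in Lfun mu p.
Proof.
case: p p0 => [r||] q0// fL; last first.
  apply/Lfun_ooP; move/Lfun_ooP : fL => [mf [M fM]].
  split; first exact: measurable_tensorize.
  by exists M; exact: (ae_tconv b0 j fM).
have fr := measurable_powR_norm fL.
apply/(Lfun_finP mu q0); move/(Lfun_finP mu q0) : fL => [mf foo].
split; first exact: measurable_tensorize.
have ge0 i : (0 <= \int[mu]_x (`|f (tconv i x)| `^ r)%:E)%E.
  by apply: integral_ge0 => x _; rewrite lee_fin powR_ge0.
(* After multiplication by the positive weight, the integral of the slice becomes one term of the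
   sum in [integral_tconv], hence at most the finite total. *)
rewrite -(@lte_pmul2l _ (b%:R ^- d)%:E)// mulry gtr0_sg// mul1e.
apply: le_lt_trans foo; rewrite (integral_tconv b0 d fr); last first.
  by move=> x; rewrite lee_fin powR_ge0.
rewrite (bigD1 j)//= leeDl// sume_ge0// => i _.
by rewrite mule_ge0// lee_fin ltW.
Qed.

(** Independence of the representative: [f] and the chosen [repr] agree off a null set, whose
    preimage under [tconv j] is null. *)
Lemma Tmap_Lpclass f j : f \in Lfun mu p ->
  Tmap b d p0 (Lpclass mu p0 f) j = Lpclass mu p0 (tensorize f j).
Proof.
move=> fL; rewrite ffunE; apply/eq_Lpclass.
- exact/tensorize_Lfun/Lfun_repr.
- exact: tensorize_Lfun.
have /eq_Lpclass :
    Lpclass mu p0 (repr (Lpclass mu p0 f) : R -> R) = Lpclass mu p0 f.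
  by rewrite Lpclass_repr.
move=> /(_ (Lfun_repr _) fL) /(ae_tconv b0 j) h.
by apply: (ae_imp _ h) => x hx _; exact: hx.
Qed.

Lemma linear_Tmap :
  linear (Tmap b d p0 : Lp01 R p0 -> tensor_space b d (Lp01 R p0)).
Proof.
move=> a F G; elim/LpW : F => f fL; elim/LpW : G => g gL.
apply/ffunP => j; rewrite -LpclassDZ// Tmap_Lpclass; last exact: (LfunDZ p0 a fL gL).
rewrite ffunE [X in _ = X + _]ffunE !Tmap_Lpclass// -LpclassDZ//;
  exact: tensorize_Lfun.
Qed.

End any_exponent.

Lemma powR_tensor_norm r (p0 : (0 < r%:E)%E) (f : tensor_space b d (Lp01 R p0)) :
  tensor_norm b d p0 f `^ r = \sum_j b%:R ^- d * Lpnorm mu p0 (f j) `^ r.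
Proof.
rewrite /tensor_norm powRKV//.
by apply: sumr_ge0 => j _; rewrite mulr_ge0 ?powR_ge0// ltW.
Qed.

Lemma tensor_norm_ge0 p (p0 : (0 < p)%E) (f : tensor_space b d (Lp01 R p0)) :
  0 <= tensor_norm b d p0 f.
Proof.
case: p p0 f => [r||] p0 f //; first exact: powR_ge0.
by apply: bigmax_ge_id.
Qed.

Lemma tensor_norm_le_oo (p0 : (0 < +oo :> \bar R)%E)
    (f : tensor_space b d (Lp01 R p0)) M : 0 <= M ->
  tensor_norm b d p0 f <= M <-> forall j, Lpnorm mu p0 (f j) <= M.
Proof.
move=> M0; split=> [/bigmax_leP[_ fM] j|fM]; first exact: fM.
by apply/bigmax_leP; split=> // j _; exact: fM.
Qed.

Lemma tensor_norm_Tmap p (p0 : (0 < p)%E) F :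
  tensor_norm b d p0 (Tmap b d p0 F) = Lpnorm mu p0 F.
Proof.
elim/LpW : F => f; case: p p0 => [r||] p0 fL //.
  have r0 : 0 < r by move: p0; rewrite lte_fin.
  apply: (powR_injective r0); rewrite ?nnegrE ?tensor_norm_ge0 ?Lpnorm_ge0//.
  apply: EFin_inj; rewrite powR_tensor_norm powR_Lpnorm// -sumEFin.
  rewrite (integral_tconv b0 d (measurable_powR_norm fL)); last first.
    by move=> x; rewrite lee_fin powR_ge0.
  apply: eq_bigr => j _; rewrite EFinM Tmap_Lpclass// powR_Lpnorm//.
  exact: tensorize_Lfun.
(* For the infinite exponent the two norms are shown to have the same nonnegative upper bounds;
   taking [M] to be each norm in turn gives equality. *)
have le_iff M : 0 <= M ->
    tensor_norm b d p0 (Tmap b d p0 (Lpclass mu p0 f)) <= M <->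
    Lpnorm mu p0 (Lpclass mu p0 f) <= M.
  move=> M0; rewrite tensor_norm_le_oo// Lpnorm_le//; split=> fM; last first.
    move=> j; rewrite Tmap_Lpclass//; apply/Lpnorm_le => //.
      exact: tensorize_Lfun.
    exact: (ae_tconv b0 j fM).
  apply: (@ae_le_tconv _ _ b0 d (fun x => `|f x|%:E)).
    by have /LfunE[mf _] := fL; apply/measurable_EFinP; exact: measurableT_comp.
  move=> j; have := fM j; rewrite Tmap_Lpclass// Lpnorm_le//.
  exact: tensorize_Lfun.
by apply/le_anti/andP; split; apply/le_iff; rewrite ?tensor_norm_ge0 ?Lpnorm_ge0.
Qed.

End isometry.

(** * The tensor quasi-norm *)

Section powR_minkowski.
Context (R : realType) (r : R) (r1 : 1 <= r).
Implicit Types u v s t : R.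

Let r0 : 0 < r. Proof. exact: lt_le_trans r1. Qed.

(** Convexity of the [r]-th power at [u / s] and [v / t]: with weights [s / (s + t)] and
    [t / (s + t)] their mean is [(u + v) / (s + t)]. *)
Lemma powR_convexD u v s t : 0 <= u -> 0 <= v -> 0 < s -> 0 < t ->
  (u + v) `^ r <= (s + t) `^ r *
    (s / (s + t) * (u / s) `^ r + t / (s + t) * (v / t) `^ r).
Proof.
move=> u0 v0 s0 t0; have st0 : 0 < s + t by exact: addr_gt0.
have l0 : 0 <= s / (s + t) by rewrite divr_ge0// ltW.
have l1 : s / (s + t) <= 1 by rewrite ler_pdivrMr// mul1r lerDl ltW.
have us : u / s \in (`[0, +oo[%classic : set R).
  by rewrite inE/= in_itv/= andbT divr_ge0// ltW.
have vt : v / t \in (`[0, +oo[%classic : set R).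
  by rewrite inE/= in_itv/= andbT divr_ge0// ltW.
have h := convex_powR r1 (Itv01 l0 l1) us vt.
rewrite convRE [X in X `^ _ <= _]convRE/= /unstable.onem in h; move: h.
have -> : 1 - s / (s + t) = t / (s + t) by field; rewrite gt_eqF.
have -> : s / (s + t) * (u / s) + t / (s + t) * (v / t) = (u + v) / (s + t).
  by field; rewrite !gt_eqF.
move=> h; rewrite (_ : u + v = (s + t) * ((u + v) / (s + t))); last first.
  by field; rewrite gt_eqF.
rewrite powRM ?divr_ge0 ?addr_ge0 ?(ltW s0) ?(ltW t0)//.
by rewrite ler_wpM2l ?powR_ge0.
Qed.

(** With [s] and [t] above the two norms on the right, summing [powR_convexD] bounds the norm of the
    sum by [s + t]; then [s] and [t] are brought down to these norms. *)
Lemma powR_sum_minkowski (I : finType) (w : R) (x y : I -> R) : 0 <= w ->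
    (forall i, 0 <= x i) -> (forall i, 0 <= y i) ->
  (\sum_i w * (x i + y i) `^ r) `^ r^-1 <=
  (\sum_i w * x i `^ r) `^ r^-1 + (\sum_i w * y i `^ r) `^ r^-1.
Proof.
move=> w0 x0 y0; set A := (_ `^ r^-1 in leRHS); set B := (X in _ <= A + X).
have sum0 (z : I -> R) : 0 <= \sum_i w * z i `^ r.
  by apply: sumr_ge0 => i _; rewrite mulr_ge0 ?powR_ge0.
have normalized (z : I -> R) s : (forall i, 0 <= z i) ->
    (\sum_i w * z i `^ r) `^ r^-1 < s -> \sum_i w * (z i / s) `^ r <= 1.
  move=> z0 zs; have s0 : 0 < s := le_lt_trans (powR_ge0 _ _) zs.
  under eq_bigr => i _ do rewrite powRM ?invr_ge0 ?(ltW s0)// mulrA.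
  rewrite -mulr_suml -[X in X * _](powRKV r0)//.
  rewrite -powRM ?powR_ge0 ?invr_ge0 ?(ltW s0)//.
  have -> : 1 = 1 `^ r :> R by rewrite powR1.
  rewrite ler_powR2r// ?divr_ge0 ?powR_ge0 ?(ltW s0)//.
  by rewrite ler_pdivrMr// mul1r ltW.
have hx s : A < s -> \sum_i w * (x i / s) `^ r <= 1 by exact: normalized.
have hy s : B < s -> \sum_i w * (y i / s) `^ r <= 1 by exact: normalized.
have A0 : 0 <= A by exact: powR_ge0.
have B0 : 0 <= B by exact: powR_ge0.
clearbody A B; apply/ler_addgt0Pr => e e0.
have e20 : 0 < e / 2 by rewrite divr_gt0.
rewrite [X in _ <= _ + X](splitr e) addrACA.
(* [A] or [B] may vanish, so the normalization divides by slightly larger numbers. *)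
set s := A + e / 2; set t := B + e / 2.
have s0 : 0 < s by rewrite ltr_wpDl.
have t0 : 0 < t by rewrite ltr_wpDl.
have st0 : 0 < s + t by exact: addr_gt0.
rewrite -(ler_powR2r r0) ?powR_ge0 ?(ltW st0)// powRKV//.
apply: (@le_trans _ _ ((s + t) `^ r * (s / (s + t) * (\sum_i w * (x i / s) `^ r)
    + t / (s + t) * (\sum_i w * (y i / t) `^ r)))).
  rewrite !mulr_sumr -big_split/= mulr_sumr; apply: ler_sum => i _.
  apply: le_trans (ler_wpM2l w0 (powR_convexD (x0 i) (y0 i) s0 t0)) _.
  by rewrite le_eqVlt; apply/orP; left; apply/eqP; ring.
rewrite -[leRHS]mulr1 ler_wpM2l ?powR_ge0//.
rewrite [leRHS](_ : 1 = s / (s + t) * 1 + t / (s + t) * 1); last first.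
  by field; rewrite gt_eqF.
by rewrite lerD// ler_wpM2l ?divr_ge0 ?(ltW s0) ?(ltW t0) ?(ltW st0)//;
  [apply: hx|apply: hy]; rewrite ltrDl.
Qed.

End powR_minkowski.

(** * Quasi-norm axioms and the crossnorm identity *)

Section tensor_norm_quasinorm.
Context (R : realType) (b d : nat) (b0 : (0 < b)%N).
Local Notation mu := (lebesgue01 R).
Local Notation tensor p0 := (tensor_space b d (Lp01 R p0)).

Let bd0 : 0 < (b%:R ^- d : R). Proof. by rewrite invr_gt0 exprn_gt0// ltr0n. Qed.

Lemma tensor_norm_eq0 p (p0 : (0 < p)%E) (f : tensor p0) :
  tensor_norm b d p0 f = 0 -> f = 0.
Proof.
move=> f0; apply/ffunP => j; rewrite [RHS]ffunE; apply: Lpnorm_eq0.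
case: p p0 f f0 => [r||] p0 f //; last first.
  move=> f0; apply/le_anti; rewrite Lpnorm_ge0 andbT -f0.
  exact: (le_bigmax 0 (fun j => Lpnorm mu p0 (f j)) j).
have r0 : 0 < r by have := p0; rewrite lte_fin.
move=> /(congr1 (@powR R ^~ r)) /=; rewrite powR_tensor_norm// powR0 ?gt_eqF//.
move/eqP; rewrite psumr_eq0; last by move=> i _; rewrite mulr_ge0 ?powR_ge0// ltW.
move=> /allP /(_ j (mem_index_enum _)) /=; rewrite mulf_eq0 gt_eqF//=.
by move=> /eqP /powR_eq0_eq0.
Qed.

Lemma tensor_normZ p (p0 : (0 < p)%E) a (f : tensor p0) :
  tensor_norm b d p0 (a *: f) = `|a| * tensor_norm b d p0 f.
Proof.
case: p p0 f => [r||] p0 f //.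
  have r0 : 0 < r by have := p0; rewrite lte_fin.
  have E : tensor_norm b d p0 (a *: f) `^ r =
      (`|a| * tensor_norm b d p0 f) `^ r.
    rewrite powRM ?tensor_norm_ge0//.
    rewrite [LHS]powR_tensor_norm [in RHS]powR_tensor_norm mulr_sumr.
    apply: eq_bigr => j _.
    by rewrite ffunE LpnormZ powRM ?Lpnorm_ge0// mulrCA.
  move: E; apply: (powR_injective r0);
    by rewrite ?nnegrE ?mulr_ge0 ?tensor_norm_ge0.
rewrite /tensor_norm (big_morph _ (fun x y => maxr_pMr x y (normr_ge0 a)) (mulr0 _)).
by apply: eq_bigr => j _; rewrite ffunE LpnormZ.
Qed.

(** For finite [p], Minkowski on each slice is followed by the discrete Minkowski inequality for the
    slice norms. *)
Lemma tensor_norm_triangle p (p0 : (0 < p)%E) : (1 <= p)%E ->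
  triangle_ineq (tensor_norm b d p0 : tensor p0 -> R).
Proof.
case: p p0 => [r||] p0 // p1 f g.
  have r0 : 0 < r by have := p0; rewrite lte_fin.
  have f0 j : 0 <= Lpnorm mu p0 (f j) by exact: Lpnorm_ge0.
  have g0 j : 0 <= Lpnorm mu p0 (g j) by exact: Lpnorm_ge0.
  rewrite /tensor_norm.
  apply: (le_trans _ (powR_sum_minkowski p1 (ltW bd0) f0 g0)).
  have sum0 (h : {ffun 'I_d -> 'I_b} -> R) : 0 <= \sum_j b%:R ^- d * h j `^ r.
    by apply: sumr_ge0 => j _; rewrite mulr_ge0 ?powR_ge0// ltW.
  rewrite ler_powR2r ?invr_gt0//; apply: ler_sum => j _.
  rewrite ler_wpM2l ?(ltW bd0)// ler_powR2r ?addr_ge0 ?Lpnorm_ge0// ffunE.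
  exact: Lpnorm_triangle.
have le_norm (h : tensor p0) j : Lpnorm mu p0 (h j) <= tensor_norm b d p0 h.
  have /tensor_norm_le_oo := lexx (tensor_norm b d p0 h); apply.
  exact: tensor_norm_ge0.
apply/tensor_norm_le_oo; first by rewrite addr_ge0 ?tensor_norm_ge0.
move=> j; rewrite ffunE; apply: le_trans (Lpnorm_triangle _ _ p1) _.
by rewrite lerD.
Qed.

Lemma tensor_norm_quasinorm p (p0 : (0 < p)%E) :
  quasinorm (tensor_norm b d p0 : tensor p0 -> R).
Proof.
split; [exact: tensor_norm_ge0|exact: tensor_norm_eq0|exact: tensor_normZ|].
have [p1|p1] := leP 1%E p.
  by exists 1 => f g; rewrite mul1r; exact: tensor_norm_triangle.
case: p p0 p1 => [r||] p0 // _.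
have r0 : 0 < r by have := p0; rewrite lte_fin.
exists (2 * 2 `^ r^-1) => f g.
have [nf ng] := (tensor_norm_ge0 f, tensor_norm_ge0 g).
rewrite -(ler_powR2r r0) ?tensor_norm_ge0 ?mulr_ge0 ?addr_ge0 ?powR_ge0//.
rewrite powRM ?mulr_ge0 ?addr_ge0 ?powR_ge0// powRM ?powR_ge0//.
rewrite (powRKV r0 (ler0n R 2)) -mulrA.
apply: (le_trans _ (ler_wpM2l (powR_ge0 _ _) (powRD_ge r0 nf ng))).
rewrite [leLHS]powR_tensor_norm [X in _ * (X + _)]powR_tensor_norm.
rewrite [X in _ * (_ + X)]powR_tensor_norm -big_split/= mulr_sumr.
apply: ler_sum => j _.
rewrite -mulrDr mulrCA ler_wpM2l ?(ltW bd0)// ffunE.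
exact: powR_LpnormD.
Qed.

(** The factors are nonnegative, so a product is maximized by maximizing each coordinate
    separately. *)
Lemma bigmax_prod_ffun (F : 'I_d -> 'I_b -> R) : (forall k i, 0 <= F k i) ->
  \big[Num.max/0]_(j : {ffun 'I_d -> 'I_b}) \prod_k F k (j k) =
  \prod_k \big[Num.max/0]_i F k i.
Proof.
move=> F0; apply/le_anti/andP; split.
  apply/bigmax_leP; split=> [|j _]; last first.
    by apply: ler_prod => k _; rewrite F0/=; exact: le_bigmax.
  by apply: prodr_ge0 => k _; exact: bigmax_ge_id.
pose m k := [arg max_(i > Ordinal b0) F k i]%O.
have mE k : \big[Num.max/0]_i F k i <= F k (m k).
  apply/bigmax_leP; split=> [|i _]; first exact: F0.
  by rewrite /m; case: Order.TotalTheory.arg_maxP => // i' _; exact.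
apply: (@le_trans _ _ (\prod_k F k ([ffun k => m k] k))).
  by apply: ler_prod => k _; rewrite bigmax_ge_id ffunE mE.
exact: (le_bigmax 0 (fun j : {ffun 'I_d -> 'I_b} => \prod_k F k (j k))).
Qed.

(** For finite [p], expanding the product of the [d] coordinate sums gives the sum over
    multi-indices, and the [d] factors [b^-1] make up the weight. *)
Lemma tensor_norm_elem p (p0 : (0 < p)%E) (v : 'I_d -> 'R^[R, b])
    (w : Lp01 R p0) :
  tensor_norm b d p0 (elem_tensor v w) =
  (\prod_(k < d) ellp_norm b p (v k)) * Lpnorm mu p0 w.
Proof.
have normE j : Lpnorm mu p0 (elem_tensor v w j) =
    (\prod_k `|v k (j k) : R|) * Lpnorm mu p0 w.
  by rewrite ffunE LpnormZ normr_prod.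
case: p p0 w normE => [r||] p0 w normE //; last first.
  rewrite /tensor_norm /ellp_norm; under eq_bigr do rewrite normE.
  rewrite -bigmax_prod_ffun// mulrC.
  rewrite (big_morph _ (fun x y => maxr_pMr x y (Lpnorm_ge0 w)) (mulr0 _)).
  by apply: eq_bigr => j _; rewrite mulrC.
have r0 : 0 < r by have := p0; rewrite lte_fin.
have ellE k : ellp_norm b r%:E (v k) `^ r =
    \sum_(i < b) b%:R^-1 * `|v k i : R| `^ r.
  rewrite /ellp_norm powRKV ?mulr_sumr//.
  by apply: sumr_ge0 => i _; rewrite mulr_ge0 ?invr_ge0 ?powR_ge0.
have ell0 k : 0 <= ellp_norm b r%:E (v k) by exact: powR_ge0.
apply: (powR_injective r0);
  rewrite ?nnegrE ?mulr_ge0 ?tensor_norm_ge0 ?Lpnorm_ge0 ?prodr_ge0//.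
rewrite powRM ?Lpnorm_ge0 ?prodr_ge0// powR_prod// [LHS]powR_tensor_norm.
under [LHS]eq_bigr => j _ do rewrite normE powRM ?Lpnorm_ge0 ?prodr_ge0// mulrA.
rewrite -mulr_suml; congr (_ * _); under [RHS]eq_bigr do rewrite ellE.
rewrite bigA_distr_bigA/=; apply: eq_bigr => j _.
by rewrite big_split/= prodr_const card_ord powR_prod// exprVn.
Qed.

End tensor_norm_quasinorm.

(** * Reasonableness *)

Section dual_norm.
Context (R : realType) (V : lmodType R) (N : V -> R).
Hypothesis N0 : forall x, 0 <= N x.
Hypothesis NZ : forall (a : R) x, N (a *: x) = `|a| * N x.
Variable phi : {linear V -> R^o}.

Lemma dual_norm_ge0 : (0 <= dual_norm N phi)%E.
Proof.
apply: ereal_sup_ubound; exists 0; last by rewrite linear0 normr0.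
by rewrite /= -[X in N X](scale0r 0) NZ normr0 mul0r.
Qed.

Lemma dual_norm_le (D : R) : 0 <= D -> (forall x, `|phi x : R| <= D * N x) ->
  (dual_norm N phi <= D%:E)%E.
Proof.
move=> D0 phiD; apply: ge_ereal_sup => _ [x /= Nx1 <-]; rewrite lee_fin.
by rewrite (le_trans (phiD x))// -[leRHS]mulr1 ler_wpM2l.
Qed.

Lemma continuous_dual_norm_lty :
  continuous_for N phi -> (dual_norm N phi < +oo)%E.
Proof.
move=> /(_ 0 1 ltr01)[del del0 phi1].
(* Scaling by [del / 2] brings the closed unit ball strictly inside radius [del], whence the bound
   [2 / del]. *)
have del2 : 0 < del / 2 by rewrite divr_gt0.
apply: (@le_lt_trans _ _ (2 / del)%:E); last exact: ltry.
apply: ge_ereal_sup => _ [x /= Nx1 <-]; rewrite lee_fin.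
have : `|phi ((del / 2) *: x) - phi 0 : R| < 1.
  apply: phi1; rewrite subr0 NZ gtr0_norm// (@le_lt_trans _ _ (del / 2))//.
    by rewrite -[leRHS]mulr1 ler_wpM2l// ltW.
  by rewrite ltr_pdivrMr// mulr_natr mulr2n ltrDl.
rewrite linear0 subr0 linearZ/= normrM gtr0_norm// => /ltW.
by rewrite mulrC -ler_pdivlMr// invf_div mul1r.
Qed.

(* Division by [N x + e] avoids the case [N x = 0]. *)
Lemma dual_normP : (dual_norm N phi < +oo)%E ->
  forall x, `|phi x : R| <= fine (dual_norm N phi) * N x.
Proof.
move=> phioo x; set D := fine _.
have D0 : 0 <= D by exact/fine_ge0/dual_norm_ge0.
have DE : dual_norm N phi = D%:E by rewrite fineK// ge0_fin_numE ?dual_norm_ge0.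
have phi_le e : 0 < e -> `|phi x : R| <= D * (N x + e).
  move=> e0; have Ne0 : 0 < N x + e by rewrite ltr_wpDl.
  rewrite -ler_pdivrMr// -lee_fin -DE; apply: ereal_sup_ubound.
  exists ((N x + e)^-1 *: x).
    by rewrite /= NZ gtr0_norm ?invr_gt0// mulrC ler_pdivrMr// mul1r lerDl ltW.
  by rewrite linearZ/= normrM gtr0_norm ?invr_gt0// mulrC.
apply/ler_addgt0Pr => e e0.
(* [D] may be zero, hence the denominator [D + 1]; the error [D * (e / (D + 1))] is at most [e]. *)
have e1 : 0 < e / (D + 1) by rewrite divr_gt0// ltr_wpDl.
apply: le_trans (phi_le _ e1) _; rewrite mulrDr lerD2l mulrCA -[leRHS]mulr1.
by rewrite ler_pM2l// ler_pdivrMr ?ltr_wpDl// mul1r lerDl.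
Qed.

End dual_norm.

(** * Functionals on the finite-dimensional factors *)

Section ellp_norm.
Context (R : realType) (b : nat).
Implicit Types (v : 'R^[R, b]).

Let delta (i : 'I_b) : 'R^[R, b] := [ffun i' => (i' == i)%:R].

Lemma ellp_norm_ge0 p v : 0 <= ellp_norm b p v.
Proof.
case: p => [r||]; first exact: powR_ge0.
  exact: bigmax_ge_id.
exact: bigmax_ge_id.
Qed.

Lemma ellp_normZ p (p0 : (0 < p)%E) (a : R) v :
  ellp_norm b p (a *: v) = `|a| * ellp_norm b p v.
Proof.
case: p p0 => [r||] // p0; last first.
  rewrite /ellp_norm (big_morph _ (fun x y => maxr_pMr x y (normr_ge0 a)) (mulr0 _)).
  by apply: eq_bigr => j _; rewrite ffunE normrM.
have r0 : 0 < r by have := p0; rewrite lte_fin.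
rewrite /ellp_norm -[X in _ = X * _](powRVK r0)// -powRM ?powR_ge0//; last first.
  by rewrite mulr_ge0 ?invr_ge0// sumr_ge0// => i _; exact: powR_ge0.
rewrite mulrCA [X in _ = (_ * X) `^ _]mulr_sumr; congr ((_ * _) `^ _).
by apply: eq_bigr => i _; rewrite ffunE normrM powRM.
Qed.

Lemma ellp_norm_abs p v v' : (forall i, `|v i : R| = `|v' i : R|) ->
  ellp_norm b p v = ellp_norm b p v'.
Proof.
by move=> vv'; rewrite /ellp_norm; case: p => [r||]; under eq_bigr do rewrite vv'.
Qed.

(** Giving each entry of [v] the sign of [phi (delta i)] leaves its norm unchanged and makes [phi]
    take the value on the left. *)
Lemma ellp_functional_le p (phi : {linear 'R^[R, b] -> R^o}) (D : R) v :
    (forall v, `|phi v : R| <= D * ellp_norm b p v) -> (forall i, 0 <= v i :> R) ->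
  \sum_i `|phi (delta i) : R| * (v i : R) <= D * ellp_norm b p v.
Proof.
move=> phiD v0; pose s i : R := (-1) ^+ ((phi (delta i) : R) < 0)%R.
pose v' : 'R^[R, b] := [ffun i => s i * v i].
have v'E : v' = \sum_i (s i * v i : R) *: delta i.
  apply/ffunP => i; rewrite sum_ffunE (bigD1 i)//= big1 ?addr0.
    by rewrite !ffunE eqxx [RHS]mulr1.
  by move=> i' ii'; rewrite !ffunE eq_sym (negbTE ii') [LHS]mulr0.
rewrite (_ : \sum_i _ = phi v'); last first.
  rewrite v'E linear_sum; apply: eq_bigr => i _.
  by rewrite linearZ/= normrEsign/= [RHS]mulrAC.
rewrite -(@ellp_norm_abs p v'); last first.
  by move=> i; rewrite ffunE normrM normr_sign mul1r.
exact: le_trans (ler_norm _) (phiD _).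
Qed.

End ellp_norm.

(* The weighted [l^1] sum is contracted one coordinate at a time; since the
   [l^r] sums of the slices add up to that of [g], no Minkowski or Hoelder
   inequality is used, and [r < 1] is allowed. *)
Lemma sum_prod_le_powR (R : realType) (r : R) (r0 : 0 < r)
    (b d : nat) (b0 : (0 < b)%N)
    (c : 'I_d -> 'I_b -> R) (D : 'I_d -> R) (g : {ffun 'I_d -> 'I_b} -> R) :
    (forall k i, 0 <= c k i) -> (forall k, 0 <= D k) ->
    (forall k (u : 'I_b -> R), (forall i, 0 <= u i) ->
      \sum_i c k i * u i <= D k * (b%:R^-1 * \sum_i u i `^ r) `^ r^-1) ->
    (forall j, 0 <= g j) ->
  \sum_(j : {ffun 'I_d -> 'I_b}) (\prod_k c k (j k)) * g j <=
  (\prod_k D k) * (\sum_j b%:R ^- d * g j `^ r) `^ r^-1.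
Proof.
elim: d c D g => [|d IHd] c D g c0 D0 cD g0.
  rewrite !(big_ffun_ord0 _ _ [ffun=> Ordinal b0]) !big_ord0.
  by rewrite !mul1r expr0 invr1 mul1r powRVK.
(* The normalized [l^r] quasi-norm of [g] along its first coordinate. *)
pose h (j : {ffun 'I_d -> 'I_b}) :=
  (b%:R^-1 * \sum_i g (fcons i j) `^ r) `^ r^-1.
have sum0 (j : {ffun 'I_d -> 'I_b}) : 0 <= \sum_i g (fcons i j) `^ r.
  by apply: sumr_ge0 => i _; exact: powR_ge0.
pose c' (k : 'I_d) := c (lift ord0 k).
rewrite big_fcons exchange_big/=.
apply: (@le_trans _ _ (\sum_(j : {ffun 'I_d -> 'I_b})
    (\prod_k c' k (j k)) * (D ord0 * h j))).
  apply: ler_sum => j _.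
  rewrite (eq_bigr (fun i => (\prod_k c' k (j k)) * (c ord0 i * g (fcons i j)))).
    rewrite -mulr_sumr ler_wpM2l//; first by apply: prodr_ge0 => k _; exact: c0.
    exact: (cD ord0 (fun i => g (fcons i j))).
  move=> i _; rewrite big_ord_recl fcons0 mulrA [X in X * _ = _]mulrC.
  by congr (_ * _ * _); apply: eq_bigr => k _; rewrite fconsS.
under [leLHS]eq_bigr => j _ do rewrite mulrCA.
rewrite -mulr_sumr big_ord_recl -mulrA.
rewrite ler_wpM2l//; have h0 j : 0 <= h j by exact: powR_ge0.
apply: le_trans (IHd c' (fun k => D (lift ord0 k)) h _ _ _ h0) _ => [k i|k|k u u0|].
- exact: c0.
- exact: D0.
- exact: cD.
rewrite ler_wpM2l//; first by apply: prodr_ge0.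
(* An equality: the power [r] undoes the root in [h], and its [b^-1] raises the weight from [b^-d]
   to [b^-(d+1)]. *)
rewrite le_eqVlt; apply/orP; left; apply/eqP; congr (_ `^ _).
rewrite big_fcons exchange_big/=; apply: eq_bigr => j _.
rewrite /h powRKV ?mulr_ge0 ?invr_ge0// mulrA -invfM -exprSr mulr_sumr.
exact: eq_bigr.
Qed.

(** * Bound on the tensor product of functionals *)

Section reasonable.
Context (R : realType) (b d : nat) (b0 : (0 < b)%N).
Variables (p : \bar R) (p0 : (0 < p)%E).
Local Notation mu := (lebesgue01 R).
Local Notation L := (Lp01 R p0).

Let delta (i : 'I_b) : 'R^[R, b] := [ffun i' => (i' == i)%:R].

Lemma tensor_functionalE phi (psi : {linear L -> R^o})
    (Phi : {linear tensor_space b d L -> R^o}) f :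
  tensor_functional phi psi Phi ->
  Phi f = \sum_(j : {ffun 'I_d -> 'I_b})
    (\prod_k (phi k (delta (j k)) : R)) * psi (f j).
Proof.
move=> PhiE; rewrite {1}(elem_tensor_span f) linear_sum.
by apply: eq_bigr => j _; rewrite PhiE.
Qed.

Lemma sum_prod_tensor_norm_le (phi : 'I_d -> {linear 'R^[R, b] -> R^o})
    (D : 'I_d -> R) (f : tensor_space b d L) :
    (forall k, 0 <= D k) ->
    (forall k v, `|phi k v : R| <= D k * ellp_norm b p v) ->
  \sum_(j : {ffun 'I_d -> 'I_b})
    (\prod_k `|phi k (delta (j k)) : R|) * Lpnorm mu p0 (f j) <=
  (\prod_k D k) * tensor_norm b d p0 f.
Proof.
move=> D0 phiD; case: p p0 f phiD => [r||] q0 f phiD //.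
  have r0 : 0 < r by have := q0; rewrite lte_fin.
  apply: (sum_prod_le_powR r0 b0 (c := fun k i => `|phi k (delta i) : R|)
    (g := fun j => Lpnorm mu q0 (f j))) => // [k u u0|j]; last exact: Lpnorm_ge0.
  pose v : 'R^[R, b] := [ffun i => u i].
  have := @ellp_functional_le R b r%:E (phi k) (D k) v (phiD k).
  have -> : ellp_norm b r%:E v = (b%:R^-1 * \sum_i u i `^ r) `^ r^-1.
    congr ((_ * _) `^ _); apply: eq_bigr => i _.
    by rewrite ffunE ger0_norm.
  under eq_bigr do rewrite ffunE.
  by apply => i; rewrite ffunE.
(* For the infinite exponent all slice norms are replaced by their maximum; the remaining sum of
   products factors over the coordinates. *)
apply: (@le_trans _ _ (\sum_(j : {ffun 'I_d -> 'I_b})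
    (\prod_k `|phi k (delta (j k)) : R|) *
    tensor_norm b d q0 f)).
  apply: ler_sum => j _; rewrite ler_wpM2l ?prodr_ge0//.
  by have [+ _] := @tensor_norm_le_oo R b d q0 f _ (tensor_norm_ge0 f); exact.
rewrite -mulr_suml ler_wpM2r ?tensor_norm_ge0//.
rewrite -(bigA_distr_bigA (fun k i => `|phi k (delta i) : R|)).
apply: ler_prod => k _; rewrite sumr_ge0//=.
(* The constant vector has sup norm at most 1, so testing on it bounds the sum of the
   [|phi k (delta i)|] by [D k]. *)
pose v : 'R^[R, b] := [ffun=> 1].
rewrite (eq_bigr (fun i => `|phi k (delta i) : R| * (v i : R))); last first.
  by move=> i _; rewrite ffunE mulr1.
apply: le_trans (ellp_functional_le (phiD k) _) _; first by move=> i; rewrite ffunE.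
rewrite -[leRHS]mulr1 ler_wpM2l//; apply/bigmax_leP; split=> // i _.
by rewrite ffunE normr1.
Qed.

Lemma tensor_norm_reasonable :
  reasonable_crossnorm (ellp_norm b p) (Lpnorm mu p0) (tensor_norm b d p0).
Proof.
split; first by split; [exact: tensor_norm_quasinorm|exact: tensor_norm_elem].
move=> phi psi phic psic; have [Phi PhiE] := tensor_functional_ex phi psi.
exists Phi => //.
have phioo k := continuous_dual_norm_lty (ellp_normZ p0) (phic k).
have psioo := continuous_dual_norm_lty (@LpnormZ _ _ _ mu _ p0) psic.
have D0 k : (0 <= dual_norm (ellp_norm b p) (phi k))%E.
  exact: dual_norm_ge0 (ellp_normZ p0) _.
have Dpsi0 : (0 <= dual_norm (Lpnorm mu p0) psi)%E.
  exact: dual_norm_ge0 (@LpnormZ _ _ _ mu _ p0) _.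
have phiP k := dual_normP (@ellp_norm_ge0 _ _ p) (ellp_normZ p0) (phioo k).
have psiP := dual_normP (@Lpnorm_ge0 _ _ _ mu _ p0)
  (@LpnormZ _ _ _ mu _ p0) psioo.
pose D := fine (dual_norm (Lpnorm mu p0) psi) *
  \prod_k fine (dual_norm (ellp_norm b p) (phi k)).
have D_ge0 : 0 <= D.
  by rewrite mulr_ge0 ?fine_ge0// prodr_ge0// => k _; exact: fine_ge0.
(* All dual norms are finite by continuity, so the extended product is the real number [D]; bounding
   by [D] then also gives finiteness. *)
have -> : ((\prod_(k < d) dual_norm (ellp_norm b p) (phi k)) *
    dual_norm (Lpnorm mu p0) psi = D%:E)%E.
  rewrite muleC EFinM fineK ?ge0_fin_numE// -prodEFin; congr (_ * _)%E.
  by apply: eq_bigr => k _; rewrite fineK// ge0_fin_numE.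
suff PhiD : (dual_norm (tensor_norm b d p0) Phi <= D%:E)%E.
  by split=> //; exact: le_lt_trans PhiD (ltry _).
apply: dual_norm_le => // f; rewrite (tensor_functionalE f PhiE).
apply: le_trans (ler_norm_sum _ _ _) _.
apply: (@le_trans _ _ (\sum_(j : {ffun 'I_d -> 'I_b})
    (\prod_k `|phi k (delta (j k)) : R|) *
    (fine (dual_norm (Lpnorm mu p0) psi) * Lpnorm mu p0 (f j)))).
  apply: ler_sum => j _; rewrite normrM normr_prod ler_wpM2l ?prodr_ge0//.
under [leLHS]eq_bigr => j _ do rewrite mulrCA.
rewrite -mulr_sumr /D -mulrA ler_wpM2l ?fine_ge0//.
by apply: sum_prod_tensor_norm_le => // k; exact: fine_ge0.
Qed.

End reasonable.

Unset Implicit Arguments.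
Set Strict Implicit.
Local Close Scope classical_set_scope.

Theorem mainTheorem1 (R : realType) (p : \bar R) (p0 : (0 < p)%E)
    (b : nat) (b2 : (2 <= b)%N) (d : nat) :
  [/\ (* [Tmap] is induced on classes by [f |-> f \o t_{b,d}] *)
      forall f : R -> R, f \in Lfun (lebesgue01 R) p ->
        forall i : {ffun 'I_d -> 'I_b},
          tensorize f i \in Lfun (lebesgue01 R) p /\
          Tmap b d p0 (Lpclass (lebesgue01 R) p0 f) i =
            Lpclass (lebesgue01 R) p0 (tensorize f i),
      linear (Tmap b d p0 : Lp01 R p0 -> tensor_space b d (Lp01 R p0)),
      forall F : Lp01 R p0,
        tensor_norm b d p0 (Tmap b d p0 F) = Lpnorm (lebesgue01 R) p0 F,
      (* a quasi-norm in general (part of [crossnorm]), a norm for [1 <= p] *)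
      (1 <= p)%E -> triangle_ineq (tensor_norm b d p0) &
      reasonable_crossnorm (ellp_norm b p) (Lpnorm (lebesgue01 R) p0)
        (tensor_norm b d p0)].
Proof.
have b0 : (0 < b)%N := ltnW b2.
split.
- by move=> f fL i; split; [exact: tensorize_Lfun|exact: Tmap_Lpclass].
- exact: linear_Tmap.
- exact: tensor_norm_Tmap.
- exact: tensor_norm_triangle.
- exact: tensor_norm_reasonable.
Qed.
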